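(* Every Lebesgue fuzzy metric space is weak $G$-complete.
   Context: A continuous $t$-norm is a binary operation $*$ on $[0,1]$ that is associative, commutative, continuous on $[0,1]\times[0,1]$, satisfies $a*1=a$ for all $a\in[0,1]$, and satisfies $a*c\le b*d$ whenever $a\le b$ and $c\le d$. A fuzzy metric space (George–Veeramani) is a triple $(X,M,* )$ where $X$ is a non-empty set, $*$ is a continuous $t$-norm and $M:X\times X\times(0,\infty)\to[0,1]$ satisfies, for all $x,y,z\in X$ and $s,t>0$: (a) $M(x,y,t)>0$; (b) $M(x,y,t)=1$ if and only if $x=y$; (c) $M(x,y,t)=M(y,x,t)$; (d) $M(x,y,t)*M(y,z,s)\le M(x,z,t+s)$; (e) $M(x,y,\cdot):(0,\infty)\to[0,1]$ is continuous. For $x\in X$, $r\in(0,1)$, $t>0$ put $B_M(x,r,t)=\{y\in X: M(x,y,t)>1-r\}$; these sets form a base of a topology $\tau_M$ on $X$. Convergence and cluster points of sequences are taken in $(X,\tau_M)$. A fuzzy metric space $(X,M,* )$ is Lebesgue if for every open cover $\mathcal G$ of $(X,\tau_M)$ there exist $r\in(0,1)$ and $t>0$ such that $\{B_M(x,r,t):x\in X\}$ refines $\mathcal G$, i.e. each $B_M(x,r,t)$ is contained in some member of $\mathcal G$. A sequence $(x_n)$ in $(X,M,* )$ is $G$-Cauchy if $\lim_{n\to\infty}M(x_n,x_{n+p},t)=1$ for each $t>0$ and $p\in\mathbb N$ (equivalently, $\lim_{n\to\infty}M(x_n,x_{n+1},t)=1$ for all $t>0$). A fuzzy metric space is weak $G$-complete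 if every $G$-Cauchy sequence in it has a cluster point in it. *)

(* Defs.v *)
From HB Require Import structures.
From mathcomp Require Import all_boot all_order all_algebra.
From mathcomp Require Import all_classical all_reals all_analysis.
From mathcomp Require Import lra.

Set Implicit Arguments.
Unset Strict Implicit.
Unset Printing Implicit Defensive.

Import Order.TTheory GRing.Theory Num.Theory.
Import numFieldNormedType.Exports.

Local Open Scope classical_set_scope.
Local Open Scope ring_scope.

(* The operation is a total function on R, but only its restriction to the
   unit square is constrained. *)
Record continuous_tnorm (R : realType) := ContinuousTNorm {
  tnorm :> R -> R -> R ;
  tnorm_itv : forall a b : R, a \in `[0, 1] -> b \in `[0, 1] ->
    tnorm a b \in `[0, 1] ;
  tnormA : forall a b c : R, a \in `[0, 1] -> b \in `[0, 1] -> c \in `[0, 1] ->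
    tnorm a (tnorm b c) = tnorm (tnorm a b) c ;
  tnormC : forall a b : R, a \in `[0, 1] -> b \in `[0, 1] ->
    tnorm a b = tnorm b a ;
  tnorm_continuous :
    {within `[0, 1] `*` `[0, 1], continuous (fun p : R * R => tnorm p.1 p.2)} ;
  tnorm1 : forall a : R, a \in `[0, 1] -> tnorm a 1 = a ;
  tnorm_le : forall a b c d : R, a \in `[0, 1] -> b \in `[0, 1] ->
    c \in `[0, 1] -> d \in `[0, 1] ->
    a <= b -> c <= d -> tnorm a c <= tnorm b d }.

(* George-Veeramani fuzzy metric spaces; fuzzy_dist x y t is relevant only
   for t > 0. *)
Record fuzzyMetricSpace (R : realType) := FuzzyMetricSpace {
  fms_carrier :> Type ;
  fms_inhabited : inhabited fms_carrier ;
  fms_tnorm : continuous_tnorm R ;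
  fuzzy_dist : fms_carrier -> fms_carrier -> R -> R ;
  fuzzy_dist_itv : forall x y (t : R), 0 < t -> fuzzy_dist x y t \in `[0, 1] ;
  fuzzy_dist_gt0 : forall x y (t : R), 0 < t -> 0 < fuzzy_dist x y t ;
  fuzzy_dist_eq1 : forall x y (t : R), 0 < t -> fuzzy_dist x y t = 1 <-> x = y ;
  fuzzy_dist_sym : forall x y (t : R), 0 < t -> fuzzy_dist x y t = fuzzy_dist y x t ;
  fuzzy_dist_triangle : forall x y z (s t : R), 0 < s -> 0 < t ->
    fms_tnorm (fuzzy_dist x y t) (fuzzy_dist y z s) <= fuzzy_dist x z (t + s) ;
  fuzzy_dist_continuous : forall x y,
    {within `]0, +oo[, continuous (fuzzy_dist x y)} }.

Definition fuzzy_ball (R : realType) (F : fuzzyMetricSpace R)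
    (x : F) (r t : R) : set F :=
  [set y | 1 - r < fuzzy_dist x y t].

Definition fuzzy_balls (R : realType) (F : fuzzyMetricSpace R) : set (set F) :=
  [set B | exists (x : F) (r t : R), [/\ 0 < r, r < 1, 0 < t & B = fuzzy_ball x r t]].

Section fuzzy_topology.
Variables (R : realType) (F : fuzzyMetricSpace R).
Implicit Types (x y z : F) (r s t u v : R).

Lemma fuzzy_dist_homo x y s t : 0 < s -> s <= t ->
  fuzzy_dist x y s <= fuzzy_dist x y t.
Proof.
move=> s0; rewrite le_eqVlt => /predU1P[->//|st].
have ts0 : 0 < t - s by rewrite subr_gt0.
have := fuzzy_dist_triangle x y y ts0 s0.
rewrite (fuzzy_dist_eq1 y y ts0).2// tnorm1 ?fuzzy_dist_itv//.
by rewrite addrC subrK.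
Qed.

Lemma fuzzy_ball_center x r t : 0 < r -> 0 < t -> fuzzy_ball x r t x.
Proof.
by move=> r0 t0; rewrite /fuzzy_ball/= (fuzzy_dist_eq1 x x t0).2// gtrBl.
Qed.

Lemma fuzzy_ball_sub x r s t u : r <= s -> 0 < t -> t <= u ->
  fuzzy_ball x r t `<=` fuzzy_ball x s u.
Proof.
move=> rs t0 tu y /= /lt_le_trans; rewrite /fuzzy_ball/= => h.
apply: le_lt_trans (h _ (fuzzy_dist_homo x y t0 tu)); lra.
Qed.

Lemma fuzzy_ball_inner x r t y : 0 < t -> fuzzy_ball x r t y ->
  exists s u, [/\ 0 < s, s < 1, 0 < u & fuzzy_ball y s u `<=` fuzzy_ball x r t].
Proof.
move=> t0 yB.
have [v [v0 vt vB]] : exists v, [/\ 0 < v, v < t & 1 - r < fuzzy_dist x y v].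
  have oI : open (`]0, +oo[%classic : set R) by exact: interval_open.
  have := fuzzy_dist_continuous (x := x) (y := y).
  rewrite (continuous_open_subspace _ oI) => /(_ t).
  rewrite inE/= in_itv/= andbT => /(_ t0) ct.
  have /nbhs_ballP[e /= e0 eB] := ct _ (open_nbhs_nbhs
    (conj (open_gt (y := 1 - r)) yB)).
  exists (t - Num.min e t / 2).
  have m0 : 0 < Num.min e t by rewrite lt_min e0.
  have me : Num.min e t <= e by rewrite ge_min lexx.
  have mt : Num.min e t <= t by rewrite ge_min lexx orbT.
  split; [lra|lra|].
  apply: eB; rewrite /ball/= opprB addrC subrK gtr0_norm; lra.
pose c := fuzzy_dist x y v.
have cI : c \in `[0, 1] by exact: fuzzy_dist_itv.
have [e e0 eB] : exists2 e, 0 < e &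
    forall w, w \in `[0, 1] -> `|1 - w| < e -> 1 - r < fms_tnorm F c w.
  have oneI : (1 : R) \in `[0, 1] by rewrite in_itv/= ler01 lexx.
  have cI2 : (`[0, 1] `*` `[0, 1])%classic ((c, 1) : R * R) by split.
  have /subspace_continuousP/(_ _ cI2) h :=
    @tnorm_continuous R (fms_tnorm F).
  have cB : 1 - r < fms_tnorm F c 1 by rewrite tnorm1.
  have := cvgr_gt _ h _ cB.
  rewrite near_withinE => nB.
  have [e /= e0 eB] := (@nbhs_ballP R (R * R)%type _ _).1 (nB (within_filter _ _)).
  exists e => // w wI we.
  apply: (eB (c, w)) => //=.
  by split => //=; exact: ballxx.
pose m := Num.min e 1.
have m0 : 0 < m by rewrite lt_min e0 ltr01.
have me : m <= e by rewrite ge_min lexx.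
have m1 : m <= 1 by rewrite ge_min lexx orbT.
have tv0 : 0 < t - v by rewrite subr_gt0.
exists (m / 2), (t - v); split; [lra|lra|by []|].
move=> z; rewrite /fuzzy_ball/= => zB.
have dI := fuzzy_dist_itv y z tv0.
have d1 : fuzzy_dist y z (t - v) <= 1 by move: dI; rewrite in_itv/= => /andP[].
have := fuzzy_dist_triangle x y z tv0 v0.
rewrite [v + _]addrC subrK; apply: lt_le_trans.
apply: eB => //; rewrite ger0_norm; lra.
Qed.

Lemma fuzzy_balls_cover : \bigcup_(B in @fuzzy_balls R F) B = setT.
Proof.
apply/seteqP; split=> // x _.
exists (fuzzy_ball x 2^-1 1); last by apply: fuzzy_ball_center; lra.
by exists x, 2^-1, 1; split=> //; lra.
Qed.

Lemma fuzzy_balls_join (A B : set F) x :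
  fuzzy_balls A -> fuzzy_balls B -> A x -> B x ->
  exists C, [/\ fuzzy_balls C, C x & C `<=` A `&` B].
Proof.
move=> [a [r [t [r0 r1 t0 ->]]]] [b [s [u [s0 s1 u0 ->]]]].
move=> /(fuzzy_ball_inner t0)[r' [t' [r'0 r'1 t'0 rB]]].
move=> /(fuzzy_ball_inner u0)[s' [u' [s'0 s'1 u'0 sB]]].
have m0 : 0 < Num.min r' s' by rewrite lt_min r'0.
have n0 : 0 < Num.min t' u' by rewrite lt_min t'0.
exists (fuzzy_ball x (Num.min r' s') (Num.min t' u')); split.
- exists x, (Num.min r' s'), (Num.min t' u'); split=> //.
  by rewrite gt_min r'1.
- exact: fuzzy_ball_center.
- move=> y yB; split.
  + by apply/rB/(fuzzy_ball_sub _ n0 _ yB); rewrite ge_min lexx.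
  + by apply/sB/(fuzzy_ball_sub _ n0 _ yB); rewrite ge_min lexx orbT.
Qed.

End fuzzy_topology.

HB.instance Definition _ (R : realType) (F : fuzzyMetricSpace R) :=
  gen_eqMixin (fms_carrier F).
HB.instance Definition _ (R : realType) (F : fuzzyMetricSpace R) :=
  gen_choiceMixin (fms_carrier F).
(* The base is the set of balls, indexed by itself. *)
HB.instance Definition _ (R : realType) (F : fuzzyMetricSpace R) :=
  isBaseTopological.Build (fms_carrier F) (@fuzzy_balls_cover R F)
    (fun A B x Ab Bb Ax Bx => fuzzy_balls_join Ab Bb Ax Bx).

Definition lebesgue_fuzzy (R : realType) (F : fuzzyMetricSpace R) :=
  forall G : set (set F), (forall U, G U -> open U) -> cover G id = setT ->
  exists r t : R, [/\ 0 < r, r < 1, 0 < t &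
    forall x : F, exists2 U, G U & fuzzy_ball x r t `<=` U].

Definition G_cauchy (R : realType) (F : fuzzyMetricSpace R) (x : nat -> F) :=
  forall (t : R) (p : nat), 0 < t ->
    fuzzy_dist (x n) (x (n + p)%N) t @[n --> \oo] --> (1 : R).

Definition weak_G_complete (R : realType) (F : fuzzyMetricSpace R) :=
  forall x : nat -> F, G_cauchy x -> exists p : F, cluster (x @ \oo) p.

(* Main.v *)
(* If a G-Cauchy sequence had no cluster point, every point would have an open
   neighbourhood meeting the sequence in at most one value. For these
   neighbourhoods a Lebesgue pair (r, t) puts x_n and x_(n+1) in a common one
   for all large n, so the sequence is eventually constant, and its eventual
   value is a cluster point after all. *)
Require Import Defs.
From mathcomp Require Import all_boot all_order all_algebra.
From mathcomp Require Import all_classical all_reals all_analysis.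

Set Implicit Arguments.
Unset Strict Implicit.
Unset Printing Implicit Defensive.

Import Order.TTheory GRing.Theory Num.Theory.

Local Open Scope classical_set_scope.
Local Open Scope ring_scope.

Lemma fuzzy_ball_open (R : realType) (F : fuzzyMetricSpace R) (x : F)
  (r t : R) : 0 < r -> r < 1 -> 0 < t -> open (fuzzy_ball x r t).
Proof.
move=> r0 r1 t0; exists [set fuzzy_ball x r t]; last by rewrite bigcup_set1.
by move=> _ ->; exists x, r, t.
Qed.

(** The radius [1 - d] is chosen so that the strict inequality defining the ball about [x] just
    fails at [y]. *)
Lemma fuzzy_accessible (R : realType) (F : fuzzyMetricSpace R) :
  accessible_space F.
Proof.
move=> x y /eqP xy; pose d := fuzzy_dist x y 1.
have d0 : 0 < d by exact: fuzzy_dist_gt0.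
have d1 : d < 1.
  have := @fuzzy_dist_itv _ _ x y 1 ltr01.
  rewrite in_itv/= -/d lt_neqAle => /andP[_ ->]; rewrite andbT.
  by apply/eqP => /(fuzzy_dist_eq1 x y ltr01).1.
exists (fuzzy_ball x (1 - d) 1); split.
- by apply: fuzzy_ball_open; rewrite ?subr_gt0// gtrBl.
- by rewrite inE; apply: fuzzy_ball_center; rewrite ?subr_gt0.
- by rewrite inE /fuzzy_ball/= subKr ltxx.
Qed.

(** Some neighbourhood of [p] misses a whole tail of the sequence. Only finitely many earlier values
    remain, and in a T1 space those different from [p] can be cut out. *)
Lemma not_cluster_isolated (T : topologicalType) (x : nat -> T) (p : T) :
  accessible_space T -> ~ cluster (x @ \oo) p ->
  exists U, [/\ open U, U p & forall n, U (x n) -> x n = p].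
Proof.
move=> T1 /existsNP[A /existsNP[B /not_implyP[[N _ NA] /not_implyP[pB AB]]]].
pose D := (x @` `I_N) `\ p.
have cD : closed D.
  move/accessible_finite_set_closed: T1; apply.
  exact/finite_setD/finite_image/finite_II.
exists (B° `&` ~` D); split.
- by apply: openI; [exact: open_interior | exact: closed_openC].
- by split=> // -[_]; exact.
- move=> n [/interior_subset xB xD]; apply: contrapT => xp; apply: xD.
  split=> //; exists n => //=; rewrite ltnNge; apply/negP => Nn.
  by apply: AB; exists (x n); split => //; exact: NA.
Qed.

Lemma cluster_eventually_const (T : topologicalType) (x : nat -> T) N :
  (forall n, (N <= n)%N -> x n.+1 = x n) -> cluster (x @ \oo) (x N).
Proof.
move=> xS A B [m _ mA] /nbhs_singleton xB.
have xE k : x (N + k)%N = x N.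
  by elim: k => [|k IH]; rewrite ?addn0// addnS xS ?leq_addr.
(* The index [N + m] lies both in the tail inside [A] and in the constant range. *)
exists (x (N + m)%N); split; last by rewrite xE.
by apply: mA; rewrite /= leq_addl.
Qed.

Theorem theorem4p1 (R : realType) (F : fuzzyMetricSpace R) :
  lebesgue_fuzzy F -> weak_G_complete F.
Proof.
move=> LF x xC; apply: contrapT => /forallNP nclu.
(* Taking all open sets on which the sequence has at most one value avoids choosing a neighbourhood
   for each point. *)
pose G := [set U : set F | open U /\
  forall m n, U (x m) -> U (x n) -> x m = x n].
have [r [t [r0 r1 t0 rtG]]] : exists r t : R, [/\ 0 < r, r < 1, 0 < t &
    forall y : F, exists2 U, G U & fuzzy_ball y r t `<=` U].
  apply: LF => [U []//|]; apply/seteqP; split=> // p _.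
  have [U [oU Up Ux]] := not_cluster_isolated (@fuzzy_accessible _ F) (nclu p).
  by exists U => //; split=> // m n /Ux -> /Ux ->.
have r1' : 1 - r < 1 by rewrite gtrBl.
have [N _ Nx] := cvgr_gt _ (xC t 1%N t0) _ r1'.
apply: (nclu (x N)); apply: cluster_eventually_const => n Nn.
(* The ball about [x n] contains its centre and, as [N <= n], also [x n.+1]; a member of [G]
   containing it forces them to be equal. *)
have [U [_ Ux] BU] := rtG (x n).
apply: Ux; apply: BU; last exact: fuzzy_ball_center.
by rewrite -addn1; exact: Nx.
Qed.
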